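(* Let $h_i^{\mathrm U}, h_j^{\mathrm D}>0$, $h_{ij}\ge 0$, $\chi\ge 0$, $W>0$ satisfy $h_{ij}(1+\chi)<\min(h_i^{\mathrm U},h_j^{\mathrm D})$. For $R_{\mathrm{tot}}\ge 0$ let $P_{ij}^{\min}(R_{\mathrm{tot}})$ be the minimum of $p^{\mathrm U}+p^{\mathrm D}$ over all $p^{\mathrm U},p^{\mathrm D}\ge 0$ with $$W\log_2\left(1+\frac{p^{\mathrm U}h_i^{\mathrm U}}{1+\chi}\right)+W\log_2\left(1+\frac{p^{\mathrm D}h_j^{\mathrm D}}{1+p^{\mathrm U}h_{ij}}\right)=R_{\mathrm{tot}},$$ and put $A=2^{R_{\mathrm{tot}}/W}$. Then $$P_{ij}^{\min}(R_{\mathrm{tot}})=\begin{cases}P_1,&\text{if } C_1 \text{ holds},\\ P_2,&\text{if } C_2\text{ holds},\\ P_3,&\text{if neither } C_1 \text{ nor } C_2\text{ holds},\end{cases}$$ where the conditions are $$C_1:\ A\le \frac{(h_j^{\mathrm D}-h_{ij})(1+\chi)}{h_i^{\mathrm U}-(1+\chi)h_{ij}},\qquad C_2:\ A\le \frac{h_i^{\mathrm U}-(1+\chi)h_{ij}}{(h_j^{\mathrm D}-h_{ij})(1+\chi)},$$ and $$P_1=\frac{A-1}{h_j^{\mathrm D}},\qquad P_2=\frac{(A-1)(1+\chi)}{h_i^{\mathrm U}},$$ $$P_3=\frac{2\sqrt{A(1+\chi)\left(h_i^{\mathrm U}-(1+\chi)h_{ij}\right)\left(h_j^{\mathrm D}-h_{ij}\right)}}{h_i^{\mathrm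 U}h_j^{\mathrm D}}+\frac{(1+A)(1+\chi)h_{ij}-h_i^{\mathrm U}-(1+\chi)h_j^{\mathrm D}}{h_i^{\mathrm U}h_j^{\mathrm D}}.$$
   Context: This describes a full-duplex base station serving a paired uplink user $i$ and downlink user $j$: $h_i^{\mathrm U}$, $h_j^{\mathrm D}$, $h_{ij}$ are the uplink, downlink and co-channel-interference carrier-to-noise ratios, $\chi$ is the normalized residual self-interference power, $W$ is the bandwidth, and $p^{\mathrm U},p^{\mathrm D}$ are the uplink and downlink transmit powers. *)

(* Defs.v *)
From Stdlib Require Import Reals.
Open Scope R_scope.

(** [hU], [hD], [hUD] are the uplink, downlink and uplink-to-downlink
    co-channel-interference carrier-to-noise ratios; [chi] is the normalized
    residual self-interference power, [W] the bandwidth, and [pU], [pD] the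
    transmit powers.  [Rlog b x] is the logarithm of [x] in base [b]. *)

Definition total_rate (hU hD hUD chi W pU pD : R) : R :=
  W * Rlog 2 (1 + pU * hU / (1 + chi))
  + W * Rlog 2 (1 + pD * hD / (1 + pU * hUD)).

(** Values of the objective [pU + pD] over the feasible set. *)
Definition achievable_power (hU hD hUD chi W Rtot P : R) : Prop :=
  exists pU pD : R,
    0 <= pU /\ 0 <= pD /\
    total_rate hU hD hUD chi W pU pD = Rtot /\
    P = pU + pD.

(** An attained lower bound, unlike an infimum. *)
Definition is_minimum (E : R -> Prop) (m : R) : Prop :=
  E m /\ forall x : R, E x -> m <= x.

(** [P] is the value P_ij^min(Rtot); it is unique when it exists. *)
Definition is_Pmin (hU hD hUD chi W Rtot P : R) : Prop :=
  is_minimum (achievable_power hU hD hUD chi W Rtot) P.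

(* Main.v *)
Require Import Defs.
From Stdlib Require Import Reals Lra.
From Coquelicot Require Import Rcomplements.
Open Scope R_scope.

(** Parametrize the feasible set by the uplink factor [x = 1 + pU hU / s],
    where [s = 1 + chi]: the rate constraint says that the downlink factor is
    [A / x], so [x] ranges over [[1, A]], and the total power becomes, up to the
    factor [hU hD], a constant plus [a x + A b / x] with [a = s (hD - hUD)] and
    [b = hU - s hUD] positive.  This function is convex with stationary point
    [sqrt (A b / a)]; [C1] says that this point lies at or below [1], and [C2]
    that it lies at or above [A]. *)

(** Exponentiating turns the sum of logarithms into a product; positivity of both factors keeps [ln]
    away from its default value [0]. *)
Lemma total_rate_eq_iff (hU hD hUD chi W Rtot pU pD : R) :
  0 < W ->
  0 < 1 + pU * hU / (1 + chi) -> 0 < 1 + pD * hD / (1 + pU * hUD) ->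
  total_rate hU hD hUD chi W pU pD = Rtot <->
  (1 + pU * hU / (1 + chi)) * (1 + pD * hD / (1 + pU * hUD))
    = Rpower 2 (Rtot / W).
Proof.
  unfold total_rate, Rlog.
  set (x := 1 + pU * hU / (1 + chi)).
  set (y := 1 + pD * hD / (1 + pU * hUD)).
  intros hW hx hy.
  assert (hl : 0 < ln 2) by (rewrite <- ln_1; apply ln_increasing; lra).
  unfold Rpower; split; intro h.
  - rewrite <- (exp_ln (x * y)) by now apply Rmult_lt_0_compat.
    f_equal; rewrite ln_mult, <- h by assumption; field; lra.
  - assert (hln : ln (x * y) = Rtot / W * ln 2) by now rewrite h, ln_exp.
    rewrite ln_mult in hln by assumption.
    replace (W * (ln x / ln 2) + W * (ln y / ln 2))
      with (W * ((ln x + ln y) / ln 2)) by (field; lra).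
    rewrite hln; field; lra.
Qed.

Definition power_at (hU hD hUD chi A x : R) : R :=
  ((1 + chi) * (hD - hUD) * x + A * (hU - (1 + chi) * hUD) / x
   + ((1 + A) * (1 + chi) * hUD - hU - (1 + chi) * hD)) / (hU * hD).

(** The map from [x] back to the powers is explicit: the uplink factor fixes [pU], and the downlink
    factor [A / x] then fixes [pD]. *)
Lemma achievable_power_iff (hU hD hUD chi W Rtot P : R) :
  0 < hU -> 0 < hD -> 0 <= hUD -> 0 <= chi -> 0 < W ->
  achievable_power hU hD hUD chi W Rtot P <->
  exists x, 1 <= x <= Rpower 2 (Rtot / W) /\
    P = power_at hU hD hUD chi (Rpower 2 (Rtot / W)) x.
Proof.
  intros hU0 hD0 hUD0 chi0 W0; unfold achievable_power, power_at.
  assert (hfac : forall u v, 0 <= u -> 0 < v -> 1 <= 1 + u / v).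
  { intros u v hu hv.
    assert (0 <= u / v) by (apply Rdiv_le_0_compat; assumption); lra. }
  split.
  - intros (pU & pD & pU0 & pD0 & hrate & ->).
    assert (hq : 0 < 1 + pU * hUD) by nra.
    assert (hx : 1 <= 1 + pU * hU / (1 + chi)) by (apply hfac; nra).
    assert (hy : 1 <= 1 + pD * hD / (1 + pU * hUD)) by (apply hfac; nra).
    apply total_rate_eq_iff in hrate; [|lra..].
    exists (1 + pU * hU / (1 + chi)); rewrite <- hrate; split.
    (* The upper bound holds because [A] is now the product of [x] with a downlink factor at least
       1. *)
    + split; [assumption|nra].
    + field; repeat split; nra.
  - intros (x & [hx1 hxA] & ->).
    set (A := Rpower 2 (Rtot / W)) in *.
    set (pU := (x - 1) * (1 + chi) / hU).
    assert (pU0 : 0 <= pU) by (apply Rdiv_le_0_compat; nra).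
    assert (hq : 0 < 1 + pU * hUD) by nra.
    assert (hA : 1 <= A / x) by (apply Rle_div_r; lra).
    exists pU, ((A / x - 1) * (1 + pU * hUD) / hD).
    assert (ex : 1 + pU * hU / (1 + chi) = x) by (unfold pU; field; lra).
    assert (ey : 1 + (A / x - 1) * (1 + pU * hUD) / hD * hD / (1 + pU * hUD)
                 = A / x) by (field; lra).
    repeat split.
    + assumption.
    + apply Rdiv_le_0_compat; nra.
    + apply total_rate_eq_iff; rewrite ?ex, ?ey; try lra.
      fold A; field; lra.
    + unfold pU; field; lra.
Qed.

(** The difference of the two sides factors through [x - t], so a sign condition replaces calculus
    and serves endpoint and interior minimizers alike. *)
Lemma add_div_le (a k t x : R) :
  0 < t -> 0 < x -> 0 <= (x - t) * (a * x * t - k) ->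
  a * t + k / t <= a * x + k / x.
Proof.
  intros ht hx h.
  assert (hd : a * x + k / x - (a * t + k / t)
               = (x - t) * (a * x * t - k) / (x * t)) by (field; lra).
  assert (0 <= (x - t) * (a * x * t - k) / (x * t))
    by (apply Rdiv_le_0_compat; [assumption|nra]).
  lra.
Qed.

(** A common optimality test for the three candidates [1], [A] and the stationary point. *)
Lemma is_Pmin_power_at (hU hD hUD chi W Rtot t : R) :
  let A := Rpower 2 (Rtot / W) in
  0 < hU -> 0 < hD -> 0 <= hUD -> 0 <= chi -> 0 < W ->
  1 <= t <= A ->
  (forall x, 1 <= x <= A ->
    0 <= (x - t) * ((1 + chi) * (hD - hUD) * x * t
                    - A * (hU - (1 + chi) * hUD))) ->
  is_Pmin hU hD hUD chi W Rtot (power_at hU hD hUD chi A t).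
Proof.
  intros A hU0 hD0 hUD0 chi0 W0 ht hopt; split.
  - apply achievable_power_iff; try assumption.
    now exists t.
  - intros P hP; apply achievable_power_iff in hP; try assumption.
    destruct hP as (x & hx & ->); fold A in hx |- *.
    apply Rmult_le_compat_r.
    + apply Rlt_le, Rinv_0_lt_compat; nra.
    + apply Rplus_le_compat_r, add_div_le; [lra|lra|now apply hopt].
Qed.

Theorem mainTheorem2 (hU hD hUD chi W Rtot : R)
    (hU_pos : 0 < hU) (hD_pos : 0 < hD) (hUD_ge0 : 0 <= hUD)
    (chi_ge0 : 0 <= chi) (W_pos : 0 < W)
    (weak_interference : hUD * (1 + chi) < Rmin hU hD)
    (Rtot_ge0 : 0 <= Rtot) :
  let A := Rpower 2 (Rtot / W) in
  let C1 := A <= (hD - hUD) * (1 + chi) / (hU - (1 + chi) * hUD) in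
  let C2 := A <= (hU - (1 + chi) * hUD) / ((hD - hUD) * (1 + chi)) in
  let P1 := (A - 1) / hD in
  let P2 := (A - 1) * (1 + chi) / hU in
  let P3 :=
    2 * sqrt (A * (1 + chi) * (hU - (1 + chi) * hUD) * (hD - hUD)) / (hU * hD)
    + ((1 + A) * (1 + chi) * hUD - hU - (1 + chi) * hD) / (hU * hD) in
  exists Pmin : R,
    is_Pmin hU hD hUD chi W Rtot Pmin /\
    (C1 -> Pmin = P1) /\
    (C2 -> Pmin = P2) /\
    (~ C1 -> ~ C2 -> Pmin = P3).
Proof.
  intros A C1 C2 P1 P2 P3.
  assert (hmin := Rmin_l hU hD); assert (hmin' := Rmin_r hU hD).
  assert (hb : 0 < hU - (1 + chi) * hUD) by lra.
  assert (hDU : 0 < hD - hUD) by nra.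
  assert (ha : 0 < (hD - hUD) * (1 + chi)) by nra.
  assert (hA : 1 <= A).
  { unfold A; rewrite <- (Rpower_O 2) by lra.
    apply Rle_Rpower; [lra|now apply Rdiv_le_0_compat]. }
  assert (iC1 : C1 <-> A * (hU - (1 + chi) * hUD) <= (hD - hUD) * (1 + chi))
    by (symmetry; now apply Rle_div_r).
  assert (iC2 : C2 <-> A * ((hD - hUD) * (1 + chi)) <= hU - (1 + chi) * hUD)
    by (symmetry; now apply Rle_div_r).
  (* At the endpoints one link is silent: the uplink at [x = 1], the downlink at [x = A]. *)
  assert (e1 : power_at hU hD hUD chi A 1 = P1)
    by (unfold power_at, P1; field; lra).
  assert (e2 : power_at hU hD hUD chi A A = P2)
    by (unfold power_at, P2; field; lra).
  destruct (Rle_dec A ((hD - hUD) * (1 + chi) / (hU - (1 + chi) * hUD)))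
    as [h1|h1]; fold C1 in h1.
  { exists (power_at hU hD hUD chi A 1); refine (conj _ (conj _ (conj _ _))).
    - apply is_Pmin_power_at; try assumption; [fold A; lra|fold A].
      intros x hx; apply iC1 in h1; apply Rmult_le_pos; nra.
    - easy.
    (* Both conditions together give [A * A * b <= A * a <= b], hence [A = 1], where the two
       endpoints coincide. *)
    - intros h2; apply iC1 in h1; apply iC2 in h2.
      assert (A = 1) as hA1 by nra.
      now rewrite <- e2, hA1.
    - easy. }
  destruct (Rle_dec A ((hU - (1 + chi) * hUD) / ((hD - hUD) * (1 + chi))))
    as [h2|h2]; fold C2 in h2.
  { exists (power_at hU hD hUD chi A A); refine (conj _ (conj _ (conj _ _))).
    - apply is_Pmin_power_at; try assumption; [fold A; lra|fold A].
      intros x hx; apply iC2 in h2.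
      (* Both factors are nonpositive, since [x <= A] and [a * x <= a * A <= b]; flipping both signs
         exposes this. *)
      replace ((x - A) * _) with
        ((A - x) * (A * (hU - (1 + chi) * hUD - (hD - hUD) * (1 + chi) * x)))
        by ring.
      apply Rmult_le_pos; [lra|]; apply Rmult_le_pos; nra.
    - easy.
    - easy.
    - easy. }
  rewrite iC1 in h1; rewrite iC2 in h2.
  apply Rnot_le_lt in h1, h2.
  set (r := sqrt (A * (1 + chi) * (hU - (1 + chi) * hUD) * (hD - hUD))).
  assert (hr0 : 0 <= r) by apply sqrt_pos.
  assert (hr : r * r = A * (hU - (1 + chi) * hUD) * ((hD - hUD) * (1 + chi))).
  { unfold r; rewrite sqrt_sqrt; [ring|].
    repeat apply Rmult_le_pos; lra. }
  (* [t] is the stationary point [sqrt (A b / a)]. *)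
  set (t := r / ((hD - hUD) * (1 + chi))).
  assert (ert : r = (hD - hUD) * (1 + chi) * t) by (unfold t; field; lra).
  (* As [r * r = A * a * b], the failure of [C1] ([a < A * b]) gives [a <= r], and that of [C2]
     ([b < A * a]) gives [r <= A * a]. *)
  assert (ht : 1 <= t <= A).
  { split.
    - apply Rle_div_r; [assumption|]; nra.
    - apply Rle_div_l; [assumption|]; nra. }
  assert (htt : (hD - hUD) * (1 + chi) * t * t = A * (hU - (1 + chi) * hUD)).
  { apply (Rmult_eq_reg_r ((hD - hUD) * (1 + chi))); [|lra].
    rewrite <- hr, ert; ring. }
  exists (power_at hU hD hUD chi A t); refine (conj _ (conj _ (conj _ _))).
  - apply is_Pmin_power_at; try assumption; fold A.
    intros x hx; rewrite <- htt.
    (* Stationarity, [a * t * t = A * b], turns the test expression into a nonnegative multiple of a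
       square. *)
    replace ((x - t) * _) with
      ((hD - hUD) * (1 + chi) * t * ((x - t) * (x - t))) by ring.
    apply Rmult_le_pos; [apply Rmult_le_pos; lra|apply Rle_0_sqr].
  - intros h; apply iC1 in h; lra.
  - intros h; apply iC2 in h; lra.
  (* The terms [a * t] and [A * b / t] both equal [r], whence the factor 2 in [P3]. *)
  - intros _ _; unfold P3, power_at; fold r.
    rewrite <- htt, ert; field; lra.
Qed.
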